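(* Let $p$ be a prime with $p\equiv 1\pmod 4$. For any integer $d$ with $\left(\frac{d}{p}\right)=1$ and any odd integer $m$ with $\frac{p-1}{2}<m<p-1$, we have $$\left(\frac{S_m(d,p)}{p}\right)\neq -1.$$
   Context: $\left(\frac{\cdot}{p}\right)$ denotes the Legendre symbol (with value $0$ on multiples of $p$). For an odd prime $p$, an integer $d$ and a positive integer $m$, $S_m(d,p)$ denotes the integer $$S_m(d,p)=\det\left[(i^2+dj^2)^m\right]_{1\leqslant i,j\leqslant (p-1)/2}.$$ *)

(* Defs.v *)
From mathcomp Require Import all_boot all_order all_algebra.

Set Implicit Arguments.
Unset Strict Implicit.
Unset Printing Implicit Defensive.

Import GRing.Theory.
Local Open Scope ring_scope.

(* The Legendre symbol (a / p), meaningful for p an odd prime; it suffices to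
   look for a square root of a modulo p among 0, ..., p - 1. *)
Definition legendre (a : int) (p : nat) : int :=
  if (p %| a)%Z then 0
  else if [exists x : 'I_p, ((x%:Z ^+ 2)%R == a %[mod p])%Z] then 1
  else -1.

(* Ordinals start at 0, whereas the rows and columns of S_m(d,p) are indexed
   by 1, ..., (p - 1) / 2: hence the successors. *)
Definition S_mx (m : nat) (d : int) (p : nat) : 'M[int]_((p.-1)./2) :=
  \matrix_(i < (p.-1)./2, j < (p.-1)./2)
    (i.+1%:Z ^+ 2 + d * j.+1%:Z ^+ 2) ^+ m.

Definition S_det (m : nat) (d : int) (p : nat) : int := \det (S_mx m d p).

(* Main.v *)
Require Import Defs.
From mathcomp Require Import all_boot all_order all_algebra.
From mathcomp Require Import perm finfield.
Import GRing.Theory.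
Local Open Scope ring_scope.

(** Put [n = (p - 1) / 2], which is even, and work in [F = 'F_p].  The entries
    of the matrix are [(x_i + d x_j) ^ m] where [x_i] and [d] are nonzero
    squares of [F], hence [n]-th roots of unity.  In the binomial expansion of
    [(x_i + d x_j) ^ m] exponents therefore only matter modulo [n]; grouping
    the terms by residues gives
      [(x_i + d x_j) ^ m = \sum_k s_k * x_i ^ (m - k) * (d x_j) ^ k],
    with [k] and [m - k] in [Z / n] and [s_k] the sum of the binomial
    coefficients ['C(m, r)] over [r = k] modulo [n] ([rootD_expE]).  The matrix
    is thus [V^T * P * diag (s_k) * diag (d ^ k) * V], where [V] is a
    Vandermonde matrix and [P] is the permutation matrix of [k |-> m - k].

    Every factor of the determinant is a square of [F]: [\det V] occurs twice;
    [d] is a square; the sign of the permutation is a square because [-1] is one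
    ([is_square_opp1], from [p = 1] modulo [4]); and [\prod_k s_k] is a square,
    because [s_k = s_(m - k)] by the symmetry of the binomial coefficients,
    whereas [k |-> m - k] has no fixed point, [n] being even and [m] odd
    ([is_square_prod_involution]). *)

(** * Squares in a field *)

Definition is_square {F : fieldType} (a : F) : Prop := exists y, a = y ^+ 2.

Lemma is_squareM (F : fieldType) (a b : F) :
  is_square a -> is_square b -> is_square (a * b).
Proof. by move=> [x ->] [y ->]; exists (x * y); rewrite exprMn. Qed.

Lemma is_squareX (F : fieldType) (a : F) k :
  is_square a -> is_square (a ^+ k).
Proof. by move=> [x ->]; exists (x ^+ k); rewrite exprAC. Qed.

Lemma is_square_prod (F : fieldType) (I : finType) (f : I -> F) :
  (forall i, is_square (f i)) -> is_square (\prod_i f i).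
Proof.
move=> sqf; elim/big_rec: _ => [|i a _]; last exact: is_squareM.
by exists 1; rewrite expr1n.
Qed.

(** The two elements of an orbit [{k, s k}] contribute the square [f k ^+ 2];
    comparing [k] with [s k] selects one element in each orbit. *)
Lemma is_square_prod_involution (F : fieldType) n (s : 'I_n -> 'I_n)
    (f : 'I_n -> F) :
  involutive s -> (forall k, s k != k) -> (forall k, f (s k) = f k) ->
  is_square (\prod_k f k).
Proof.
move=> sK s_neq fs; exists (\prod_(k : 'I_n | (k < s k)%N) f k).
rewrite (bigID (fun k : 'I_n => (k < s k)%N)) /= expr2; congr (_ * _).
rewrite (reindex_inj (inv_inj sK)) /=; apply: eq_big => [k|k _]; last exact: fs.
by rewrite sK -leqNgt [RHS]ltn_neqAle eq_sym s_neq.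
Qed.

(** * Powers of sums of roots of unity *)

(** The coefficient of [y ^ k] in [(1 + y) ^ m] modulo [y ^ n.+1 - 1]. *)
Definition cyclic_bin (F : fieldType) (m n : nat) (k : 'I_n.+1) : F :=
  \sum_(r < m.+1 | inZp r == k) 'C(m, r)%:R.

(** The difference is taken in the group [Z / n.+1] carried by ['I_n.+1]. *)
Definition reflect_mod (m n : nat) (k : 'I_n.+1) : 'I_n.+1 := inZp m - k.

Lemma reflect_modK m n : involutive (reflect_mod m n).
Proof. by move=> k; rewrite /reflect_mod subKr. Qed.

Lemma inZp_sub m n r : (r <= m)%N -> inZp (m - r) = reflect_mod m n (inZp r).
Proof.
move=> le_rm; apply/eqP; rewrite /reflect_mod -subr_eq opprK.
by apply/eqP/val_inj; rewrite /= modnDm subnK.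
Qed.

(** A fixed point would satisfy [2 k = m] modulo [n.+1], and an even modulus
    preserves parity. *)
Lemma reflect_mod_neq m n (k : 'I_n.+1) :
  ~~ odd n.+1 -> odd m -> reflect_mod m n k != k.
Proof.
move=> /negbTE n_even m_odd; rewrite /reflect_mod subr_eq.
apply/eqP => /(congr1 (fun i : 'I_n.+1 => odd i)) /=.
by rewrite !odd_mod // oddD addbb m_odd.
Qed.

(** Reindexing by [r |-> m - r] exchanges the two residue classes and preserves
    ['C(m, r)]. *)
Lemma cyclic_bin_reflect (F : fieldType) m n (k : 'I_n.+1) :
  cyclic_bin F m n (reflect_mod m n k) = cyclic_bin F m n k.
Proof.
rewrite /cyclic_bin (reindex_inj rev_ord_inj) /=.
apply: eq_big => [r|r _]; rewrite subSS.
  by rewrite inZp_sub ?leq_ord // (inj_eq (inv_inj (reflect_modK m n))).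
by rewrite bin_sub ?leq_ord.
Qed.

(** Both exponents [m - r] and [r] of a binomial term can be reduced modulo
    [n.+1], so terms are grouped by the residue [k] of [r]. *)
Lemma rootD_expE (F : fieldType) m n (x y : F) :
  x ^+ n.+1 = 1 -> y ^+ n.+1 = 1 ->
  (x + y) ^+ m =
    \sum_k x ^+ (reflect_mod m n k) * (cyclic_bin F m n k * y ^+ k).
Proof.
move=> xn1 yn1; rewrite exprDn.
rewrite (partition_big (fun r : 'I_m.+1 => inZp r : 'I_n.+1) predT) //.
apply: eq_bigr => k _; rewrite mulr_suml mulr_sumr; apply: eq_bigr => r /eqP <-.
rewrite -inZp_sub ?leq_ord //= !expr_mod //.
by rewrite -mulr_natl mulrCA mulrA.
Qed.

(** The factorisation [V^T * P * D * V] of the matrix, with [V] a Vandermonde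
    matrix, reduces its determinant to a product of squares.  The sign of the
    permutation is left undetermined: it is a power of [-1], itself a square. *)
Lemma is_square_det_powers (F : fieldType) m n (x : 'I_n -> F) (d : F) :
    ~~ odd n -> odd m -> is_square (-1 : F) -> is_square d ->
    (forall i, x i ^+ n = 1) -> d ^+ n = 1 ->
  is_square (\det (\matrix_(i, j) (x i + d * x j) ^+ m)).
Proof.
case: n x => [|n] x n_even m_odd sqN1 sqd xn1 dn1.
  by exists 1; rewrite det_mx00 expr1n.
pose V : 'M[F]_n.+1 := \matrix_(k, i) x i ^+ k.
pose s := perm (inv_inj (reflect_modK m n)).
pose D := diag_mx (\row_k (cyclic_bin F m n k * d ^+ k)).
have -> : \matrix_(i, j) (x i + d * x j) ^+ m = (row_perm s V)^T *m (D *m V).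
  apply/matrixP => i j; rewrite !mxE.
  rewrite (rootD_expE _ _ n) ?exprMn ?xn1 ?dn1 ?mulr1 //.
  apply: eq_bigr => k _; rewrite mul_diag_mx !mxE permE.
  by rewrite exprMn !mulrA.
rewrite !det_mulmx det_tr row_permE det_mulmx det_perm det_diag.
have -> (a b c : F) : a * b * (c * b) = a * c * b ^+ 2.
  by rewrite mulrACA -expr2.
apply: is_squareM; last by exists (\det V).
apply: is_squareM; first exact: is_squareX.
under eq_bigr do rewrite mxE.
rewrite big_split /=; apply: is_squareM; last first.
  by apply: is_square_prod => k; exact: is_squareX.
apply: (is_square_prod_involution _ _ (reflect_mod m n)) => [|k|k].
- exact: reflect_modK.
- exact: reflect_mod_neq.
- exact: cyclic_bin_reflect.
Qed.

(** * Prime fields and the Legendre symbol *)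

Lemma expf_pred_prime p (x : 'F_p) : prime p -> x != 0 -> x ^+ p.-1 = 1.
Proof.
move=> p_pr x_neq0; apply: (mulfI x_neq0).
by rewrite -exprS prednK ?prime_gt0 // mulr1 -[RHS]expf_card card_Fp.
Qed.

Lemma half_pred_mod4 p : p = 1 %[mod 4] -> (p.-1)./2 = (p %/ 4).*2.
Proof.
move=> p1; rewrite {1}(divn_eq p 4) p1 addn1 /=.
by rewrite (mulnA _ 2%N 2%N) !muln2 doubleK.
Qed.

Lemma half_pred_even p : p = 1 %[mod 4] -> ~~ odd (p.-1)./2.
Proof. by move=> /half_pred_mod4 ->; rewrite odd_double. Qed.

Lemma half_pred_double p : p = 1 %[mod 4] -> ((p.-1)./2 * 2 = p.-1)%N.
Proof.
move=> p1; rewrite half_pred_mod4 // [in RHS](divn_eq p 4) p1 addn1 /=.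
by rewrite (mulnA _ 2%N 2%N) !muln2.
Qed.

Lemma expf_half_square p (a : 'F_p) :
  prime p -> p = 1 %[mod 4] -> is_square a -> a != 0 ->
  a ^+ (p.-1)./2 = 1.
Proof.
move=> p_pr p1 [y ->]; rewrite expf_eq0 /= => y_neq0.
by rewrite -exprM mulnC half_pred_double // expf_pred_prime.
Qed.

(** Some nonzero [y] is not a root of [X ^ ((p - 1) / 2) - 1], for reasons of
    degree, so [y ^ ((p - 1) / 2) = -1]; the exponent is even, whence the square
    root [y ^ ((p - 1) / 4)] of [-1]. *)
Lemma is_square_opp1 p : prime p -> p = 1 %[mod 4] -> is_square (-1 : 'F_p).
Proof.
move=> p_pr p1; set n := (p.-1)./2.
have p1_gt0 : (0 < p.-1)%N by rewrite -subn1 subn_gt0 prime_gt1.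
have p1E : (n * 2)%N = p.-1 by exact: half_pred_double.
have n_gt0 : (0 < n)%N by move: p1_gt0; rewrite -p1E muln_gt0 andbT.
(* Otherwise all [p - 1 = 2 n] nonzero elements are [n]-th roots of unity. *)
have [y y_neq0 yn1] : exists2 y : 'F_p, y != 0 & y ^+ n != 1.
  apply/exists_inP; apply: contraT; rewrite negb_exists_in => /forall_inP no_y.
  have : (size (enum (predC1 (0%R : 'F_p))) <= n)%N.
    apply: max_unity_roots => //; last exact: enum_uniq.
    apply/allP => y; rewrite mem_enum => /no_y; rewrite negbK.
    by move=> /eqP yn1; apply/unity_rootP.
  rewrite -cardE cardC1 card_Fp // -p1E muln2 -addnn -{3}[n]addn0.
  by rewrite leq_add2l leqNgt n_gt0.
exists (y ^+ n./2); rewrite -exprM muln2 even_halfK ?half_pred_even //.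
have : y ^+ n ^+ 2 == 1 by rewrite -exprM p1E expf_pred_prime.
by rewrite sqrf_eq1 (negPf yn1) /= => /eqP ->.
Qed.

Lemma intr_Fp_eq0 p (a : int) :
  prime p -> (a%:~R == 0 :> 'F_p) = (p %| a)%Z.
Proof. by move=> p_pr; rewrite (dvdz_pcharf (pchar_Fp p_pr)). Qed.

Lemma intr_Fp_eq p (a b : int) :
  prime p -> (a%:~R == b%:~R :> 'F_p) = (a == b %[mod p])%Z.
Proof.
by move=> p_pr; rewrite eqz_mod_dvd -intr_Fp_eq0 // rmorphB subr_eq0.
Qed.

Lemma legendre1_square p (a : int) :
  prime p -> legendre a p = 1 ->
  (a%:~R != 0 :> 'F_p) /\ is_square (a%:~R : 'F_p).
Proof.
move=> p_pr; rewrite /legendre intr_Fp_eq0 //; case: ifP => // _.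
case: ifP => // /existsP [x]; rewrite -intr_Fp_eq // => /eqP <- _.
by split=> //; exists (x%:Z)%:~R; rewrite rmorphXn.
Qed.

Lemma legendre_square_neqN1 p (a : int) :
  prime p -> is_square (a%:~R : 'F_p) -> legendre a p <> -1.
Proof.
move=> p_pr [y ay]; rewrite /legendre; case: ifP => // _; case: ifP => //.
move=> /negbT/negP []; apply/existsP.
have y_lt : (y < p)%N by rewrite -[X in (_ < X)%N](Fp_cast p_pr).
exists (Ordinal y_lt); rewrite -intr_Fp_eq // ay rmorphXn /=.
by rewrite -pmulrn natr_Zp.
Qed.

(** * The determinant modulo p *)

Theorem theorem1p2 (p : nat) (d : int) (m : nat) :
  prime p -> p = 1 %[mod 4] ->
  legendre d p = 1 ->
  odd m -> ((p.-1)./2 < m)%N -> (m < p.-1)%N ->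
  legendre (S_det m d p) p <> -1.
Proof.
move=> p_pr p1 /(legendre1_square _ _ p_pr) [d_neq0 sqd] m_odd _ _.
apply: legendre_square_neqN1 => //.
pose x (i : 'I_(p.-1)./2) : 'F_p := i.+1%:R ^+ 2.
have -> : (S_det m d p)%:~R =
    \det (\matrix_(i, j) (x i + d%:~R * x j) ^+ m) :> 'F_p.
  rewrite /S_det /S_mx -(det_map_mx (intmul (1 : 'F_p))); congr (\det _).
  apply/matrixP => i j; rewrite !mxE (rmorphXn (intmul (1 : 'F_p))).
  by rewrite rmorphD rmorphM !rmorphXn.
apply: is_square_det_powers => //.
- exact: half_pred_even.
- exact: is_square_opp1.
- move=> i; apply: expf_half_square => //; first by exists i.+1%:R.
  rewrite expf_eq0 /= -(dvdn_pcharf (pchar_Fp p_pr)) gtnNdvd //.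
  have i_lt : (i.+1 <= (p.-1)./2 * 2)%N.
    by rewrite (leq_trans (ltn_ord i)) // leq_pmulr.
  rewrite half_pred_double // in i_lt.
  by rewrite -[X in (_ < X)%N](prednK (prime_gt0 p_pr)).
- exact: expf_half_square.
Qed.
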